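(* Let $X$ be a Banach space such that every convex series of slices of $B_X$ intersects the unit sphere $S_X$. Then $\mathrm{SCD}(B_X)=\emptyset$. If, moreover, $X$ is separable, then $X$ is not an SCD space and, in particular, $X$ contains an isomorphic copy of $\ell_1$.
   Context: Banach spaces are over $\mathbb{K}=\mathbb{R}$ or $\mathbb{C}$; $B_X$, $S_X$, $X^*$ denote the closed unit ball, the unit sphere and the topological dual of $X$. A slice of a bounded set $A\subseteq X$ is a non-empty intersection of $A$ with an open half-space; it can be written as $S(A,x^*,\alpha)=\{x\in A:\operatorname{Re}x^*(x)>\sup_{b\in A}\operatorname{Re}x^*(b)-\alpha\}$ with $x^*\in X^*$, $\alpha>0$. A convex series of slices of $A$ is a set of the form $\sum_{i=1}^\infty\lambda_iS_i=\{\sum_{i=1}^\infty\lambda_ix_i:x_i\in S_i\}$, where each $S_i$ is a slice of $A$, $\lambda_i\ge0$ and $\sum_{i=1}^\infty\lambda_i=1$. Let $A\subseteq X$ be bounded and convex and $a\in A$. A countable collection $\{V_n:n\in\mathbb{N}\}$ of non-empty subsets of $A$ is determining for $a$ if $a\in\overline{\mathrm{conv}}(B)$ whenever $B\subseteq A$ intersects all the sets $V_n$. The point $a$ is an SCD point (slicely countably determined point) of $A$ if there is a sequence of slices of $A$ that is determining for $a$; $\mathrm{SCD}(A)$ is the set of all SCD points of $A$. A bounded convex set $A$ is an SCD set if there is a sequence $\{S_n:n\in\mathbb{N}\}$ of slices of $A$ such that $A\subseteq\overline{\mathrm{conv}}(B)$ whenever $B\subseteq A$ intersects all the $S_n$.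 A Banach space $X$ is an SCD space if every bounded convex subset of $X$ is an SCD set. *)

(* Defs.v *)
From HB Require Import structures.
From mathcomp Require Import all_boot all_order all_algebra.
From mathcomp Require Import complex.
From mathcomp Require Import all_classical all_reals all_analysis.

Set Implicit Arguments.
Unset Strict Implicit.
Unset Printing Implicit Defensive.

Import Order.TTheory GRing.Theory Num.Theory.
Import numFieldNormedType.Exports.

Local Open Scope classical_set_scope.
Local Open Scope ring_scope.

Variant scalar_kind := RealScalars | ComplexScalars.

Definition scalar_field (R : realType) (s : scalar_kind) : numFieldType :=
  match s with
  | RealScalars => R
  | ComplexScalars => R[i]
  end.

Definition re (R : realType) (s : scalar_kind) : scalar_field R s -> R :=
  match s with
  | RealScalars => fun z : R => z
  | ComplexScalars => fun z : R[i] => complex.Re z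
  end.

Section SCD.
Context {R : realType} {s : scalar_kind}.
Local Notation K := (scalar_field R s).
Context {X : completeNormedModType K}.
Implicit Types (A B S : set X) (V : nat -> set X) (a x : X).

Definition unit_ball : set X := [set x | `|x| <= 1].

Definition unit_sphere : set X := [set x | `|x| = 1].

(* For x* = 0 the slice of A is A itself. When X is non-trivial a bounded A is
   also a slice for some x* <> 0; only for X = {0} does allowing x* = 0
   matter: it is what makes {0} a slice of the unit ball {0}. *)
Definition slice A (f : {linear X -> K^o}) (alpha : R) : set X :=
  [set x | A x /\ sup [set re (f b) | b in A] - alpha < re (f x)].

Definition is_slice A S :=
  S !=set0 /\
  exists (f : {linear X -> K^o}) (alpha : R),
    [/\ continuous f, 0 < alpha & S = slice A f alpha].

(* The weights lie in K, where [0 <= l i] forces them to be real. *)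
Definition is_convex_series_of_slices A (C : set X) :=
  exists (l : nat -> K) (S : nat -> set X),
    [/\ forall i, 0 <= l i,
        series l @ \oo --> (1 : K),
        forall i, is_slice A (S i)
      & C = [set x | exists y : nat -> X, (forall i, S i (y i)) /\
                       series (fun i => l i *: y i) @ \oo --> x]].

Definition convex_hull B : set X := smallest (@convex_set K X) B.

Definition closed_convex_hull B : set X := closure (convex_hull B).

Definition determining A a V :=
  (forall n, V n !=set0 /\ V n `<=` A) /\
  forall B, B `<=` A -> (forall n, B `&` V n !=set0) -> closed_convex_hull B a.

Definition SCD A : set X :=
  [set a | A a /\
     exists V, (forall n, is_slice A (V n)) /\ determining A a V].

Definition SCD_set A :=
  exists V, (forall n, is_slice A (V n)) /\
    forall B, B `<=` A -> (forall n, B `&` V n !=set0) -> A `<=` closed_convex_hull B.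

End SCD.

Section spaces.
Context {R : realType} {s : scalar_kind}.
Local Notation K := (scalar_field R s).
Implicit Type X : completeNormedModType K.

(* The empty set has no slices, hence would never be an SCD set: it is
   excluded, since otherwise no space at all would be an SCD space. *)
Definition SCD_space X :=
  forall A : set X, A !=set0 -> bounded_set A -> @convex_set K X A -> SCD_set A.

Definition separable X := exists2 D : set X, countable D & dense D.

(* [`|x|] lies in K; applying [re] yields the same nonnegative real in R. *)
Definition l1_norm (a : nat -> K) : \bar R :=
  (\sum_(n <oo) (re `|a n|)%:E)%E.

Definition l1 : set (nat -> K) := [set a | (l1_norm a < +oo)%E].

(* T is an isomorphism of l1 onto its range; its values outside l1 are
   irrelevant. *)
Definition contains_l1 X :=
  exists T : (nat -> K) -> X,
    (forall (k : K) (a b : nat -> K), l1 a -> l1 b ->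
       T (fun n => k * a n + b n) = k *: T a + T b) /\
    exists c C : R, [/\ 0 < c, 0 < C
      & forall a, l1 a ->
          (c%:E * l1_norm a <= (re `|T a|)%:E <= C%:E * l1_norm a)%E].

End spaces.

(* Main.v *)
Require Import Defs.
From HB Require Import structures.
From mathcomp Require Import all_boot all_order all_algebra.
From mathcomp Require Import complex ring lra.
From mathcomp Require Import all_classical all_reals all_analysis.

Set Implicit Arguments.
Unset Strict Implicit.
Unset Printing Implicit Defensive.

Import Order.TTheory GRing.Theory Num.Theory.
Import numFieldNormedType.Exports.

Local Open Scope classical_set_scope.
Local Open Scope ring_scope.

(** The hypothesis turns any sequence [S n] of slices of the unit ball into a
    single functional. A convex series of the slices with strictly positive
    weights [2^-(n+1)] contains a point [z = sum 2^-(n+1) y n] of norm 1, with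
    [y n] in [S n]; a functional [u] of norm 1 attaining its norm at [z]
    satisfies [u (y n) <= 1] and [sum 2^-(n+1) u (y n) = 1], so it equals 1 at
    every [y n]. This is [slices_common_functional]; it rests on the
    Hahn-Banach theorem, which is proved here for sublinear functionals on a
    real vector space.

    If slices [V n] were determining for a point [a] of the ball, one could
    apply this to the slices [V n] and [- V n] together: the points found in
    the [V n] would force [u a >= 1], and the opposites of those found in the
    [- V n] would force [u a <= -1]. Hence the ball has no SCD point. In
    particular 0 is not one, so the ball is not an SCD set.

    To find l1 in a separable [X], one looks at families [G] of functionals of
    norm at most 1 that behave like the unit vector basis of l1: for any
    finitely many members and any prescribed phases, some point of the ball
    makes each member nearly equal to 1 after rotation by its phase. The
    points doing this for given data contain a slice, defined by a sum of
    rotated members of [G]. When [G] is countable there are only countably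
    many such slices, and a functional equal to 1 somewhere in each of them
    enlarges [G] ([phase_free_extend]). A maximal family, given by Zorn's
    lemma, is therefore uncountable.

    Since [X] is separable, all but countably many points of an uncountable
    part of [G] are condensation points of it for pointwise convergence.
    Prescribing different phases at different condensation points yields,
    inductively, points [x n] of the ball such that every prescription of
    phases to [x 0, ..., x (n-1)] is nearly realised by uncountably many
    members of [G] ([branch_extend], [phase_sequence]). Choosing the phases to
    match given coefficients [a k] shows that the norm of [sum a k x k] is at
    least [(1/8) sum |a k|], so that [a |-> sum a k x k] embeds l1.

    Functionals are handled throughout through their real parts, so that the
    real and the complex case are treated at once; the passage back to scalar
    functionals is needed only to recognise slices. *)

(** * Real and complex scalars *)

Section scalars.
Context {R : realType} {s : scalar_kind}.
Local Notation K := (scalar_field R s).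

Definition of_real (r : R) : K :=
  match s return scalar_field R s with
  | RealScalars => r
  | ComplexScalars => r%:C%C
  end.

Lemma of_realD a b : of_real (a + b) = of_real a + of_real b.
Proof. by rewrite /of_real; case: s => //; rewrite rmorphD. Qed.

Lemma of_realM a b : of_real (a * b) = of_real a * of_real b.
Proof. by rewrite /of_real; case: s => //; rewrite rmorphM. Qed.

Lemma of_real1 : of_real 1 = 1.
Proof. by rewrite /of_real; case: s. Qed.

Lemma of_real0 : of_real 0 = 0.
Proof. by rewrite /of_real; case: s. Qed.

Lemma of_realN a : of_real (- a) = - of_real a.
Proof. by rewrite /of_real; case: s => //; rewrite rmorphN. Qed.

Lemma re_of_real a : re (of_real a) = a.
Proof. by rewrite /of_real /re; case: s. Qed.

Lemma reD (x y : K) : re (x + y) = re x + re y.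
Proof. by move: x y; rewrite /re; case: s => //= -[? ?] [? ?]. Qed.

Lemma reN (x : K) : re (- x) = - re x.
Proof. by move: x; rewrite /re; case: s => //= -[? ?]. Qed.

Lemma re0 : re (0 : K) = 0.
Proof. by rewrite -of_real0 re_of_real. Qed.

Lemma re1 : re (1 : K) = 1.
Proof. by rewrite -of_real1 re_of_real. Qed.

Lemma re_realM a (x : K) : re (of_real a * x) = a * re x.
Proof.
move: x; rewrite /re /of_real; case: s => [x|[x y]]; first by [].
by rewrite /= mul0r subr0.
Qed.

Lemma ler_of_real a b : (of_real a <= of_real b) = (a <= b).
Proof. by rewrite /of_real; case: s => //=; rewrite lecR. Qed.

Lemma ltr_of_real a b : (of_real a < of_real b) = (a < b).
Proof. by rewrite /of_real; case: s => //=; rewrite ltcR. Qed.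

Lemma re_ge0K (x : K) : 0 <= x -> of_real (re x) = x.
Proof.
move: x; rewrite /re /of_real; case: s => //= -[a b]; rewrite lecE /=.
by move=> /andP[/eqP -> _].
Qed.

Lemma of_real_re_norm (x : K) : of_real (re `|x|) = `|x|.
Proof. by rewrite re_ge0K. Qed.

Lemma re_norm_ge0 (x : K) : 0 <= re `|x|.
Proof. by rewrite -ler_of_real of_real0 of_real_re_norm. Qed.

Lemma norm_of_real a : `|of_real a| = of_real `|a|.
Proof.
rewrite /of_real; case: s => //=.
by rewrite normc_def/= expr0n addr0 sqrtr_sqr.
Qed.

(** The powers of [phase] form a finite group of unimodular scalars that
    contains -1. Finiteness keeps the choices of phases for finitely many
    points finite in number; [rotate] says that the group is fine enough. *)
Definition phase : K :=
  match s return scalar_field R s with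
  | RealScalars => -1
  | ComplexScalars => 'i%C
  end.

Lemma phase4 : phase ^+ 4 = 1.
Proof.
rewrite /phase; case: s => /=.
  by rewrite -signr_odd.
by rewrite (exprM _ 2 2) sqr_i sqrrN expr1n.
Qed.

Lemma norm_phase n : `|phase ^+ n| = 1.
Proof.
rewrite normrX; suff -> : `|phase| = 1 by rewrite expr1n.
rewrite /phase; case: s => /=; first by rewrite normrN1.
by rewrite normc_def/= expr0n add0r expr1n sqrtr1.
Qed.

Lemma phase_opp : exists n, phase ^+ n = -1.
Proof.
rewrite /phase; case: s => /=; first by exists 1%N; rewrite expr1.
by exists 2%N; rewrite sqr_i.
Qed.

(** One of the four numbers [x], [- y], [- x], [y], the real parts of the
    rotations of [x + i y], is at least half of [|x| + |y|]. *)
Lemma rotate (b : K) : exists n, re `|b| <= 2 * re (phase ^+ n * b).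
Proof.
move: b; rewrite /phase /re; case: s => [b|[x y]].
  have [b0|b0] := lerP 0 b.
    by exists 0%N; rewrite expr0 mul1r ger0_norm//; lra.
  by exists 1%N; rewrite expr1 ltr0_norm//; lra.
set nb := complex.Re _.
have nb_le : nb <= `|x| + `|y|.
  rewrite /nb normc_def/= -(ger0_norm (addr_ge0 (normr_ge0 x) (normr_ge0 y))).
  rewrite -sqrtr_sqr ler_wsqrtr// sqrrD -!normrX !(ger0_norm (sqr_ge0 _)).
  by rewrite -addrA lerD2l lerDr mulrn_wge0// mulr_ge0.
have e0 : complex.Re ('i%C ^+ 0 * (x +i* y)%C) = x by rewrite expr0 mul1r.
have e1 : complex.Re ('i%C ^+ 1 * (x +i* y)%C) = - y by rewrite expr1 /=; ring.
have e2 : complex.Re ('i%C ^+ 2 * (x +i* y)%C) = - x by rewrite sqr_i mulN1r.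
have e3 : complex.Re ('i%C ^+ 3 * (x +i* y)%C) = y.
  by rewrite exprS sqr_i mulrN1 /=; ring.
suff [|[|[|]]] : nb <= 2 * x \/ nb <= 2 * - y \/ nb <= 2 * - x \/ nb <= 2 * y.
- by exists 0%N; rewrite ?e0.
- by exists 1%N; rewrite ?e1.
- by exists 2%N; rewrite ?e2.
- by exists 3%N; rewrite ?e3.
have [xy|xy] := lerP `|y| `|x|.
  have [x0|x0] := lerP 0 x.
    by left; move: xy nb_le; rewrite (ger0_norm x0); lra.
  by right; right; left; move: xy nb_le; rewrite (ltr0_norm x0); lra.
have [y0|y0] := lerP 0 y.
  by right; right; right; move: xy nb_le; rewrite (ger0_norm y0); lra.
by right; left; move: xy nb_le; rewrite (ltr0_norm y0); lra.
Qed.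

(** [|1 - b/2|^2 = 5/4 - re b <= 3/4 < (7/8)^2]. *)
Lemma norm_sub_half (b : K) : re `|b| = 1 -> 1 <= 2 * re b ->
  re `|1 - of_real 2^-1 * b| <= 7 / 8.
Proof.
move: b; rewrite /re /of_real; case: s => [b|[x y]].
  have [b0|b0] := lerP 0 b.
    by rewrite (ger0_norm b0) => -> _; rewrite ger0_norm; lra.
  by rewrite (ltr0_norm b0); lra.
rewrite !normc_def/= => nb x1.
have {}nb : x ^+ 2 + y ^+ 2 = 1.
  by rewrite -[LHS]sqr_sqrtr ?nb ?expr1n// addr_ge0 ?sqr_ge0.
rewrite -[leRHS]ger0_norm; last lra.
rewrite -sqrtr_sqr ler_wsqrtr// !mul0r subr0 addr0 add0r.
nra.
Qed.

End scalars.

(** * The Hahn-Banach theorem *)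

Section hahn_banach.
Context {R : realType} {V : lmodType R}.
Implicit Types (p q u : V -> R) (x y : V).

Definition sublinear q :=
  (forall x y, q (x + y) <= q x + q y) /\
  (forall t x, 0 < t -> q (t *: x) <= t * q x).

Lemma sublinear0 q : sublinear q -> q 0 = 0.
Proof.
move=> [_ qZ]; have := qZ 2 0 (@ltr0Sn R 1); have := qZ 2^-1 0.
by rewrite !scaler0 => /(_ ltac:(lra)); lra.
Qed.

Lemma sublinear_ge q x : sublinear q -> - q (- x) <= q x.
Proof.
move=> sq; have := sq.1 x (- x); rewrite subrr sublinear0//; lra.
Qed.

(** The common core of two constructions: the infimum of a chain of sublinear
    functionals, and the infimum defining [straighten]. *)
Lemma sublinear_inf I (D : set I) (F : I -> V -> R) :
  D !=set0 ->
  (forall x, has_lbound [set F i x | i in D]) ->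
  (forall i j x y, D i -> D j ->
     exists2 k, D k & F k (x + y) <= F i x + F j y) ->
  (forall i t x, D i -> 0 < t ->
     exists2 k, D k & F k (t *: x) <= t * F i x) ->
  sublinear (fun x => inf [set F i x | i in D]).
Proof.
move=> [i0 Di0] lbF FD FZ.
have infF i x : D i -> inf [set F i x | i in D] <= F i x.
  by move=> Di; apply: ge_inf => //; exists i.
have n0 x : [set F i x | i in D] !=set0 by exists (F i0 x), i0.
split=> [x y|t x t0].
  rewrite -lerBlDr; apply: lb_le_inf => // _ [i Di <-].
  rewrite lerBlDr -lerBlDl; apply: lb_le_inf => // _ [j Dj <-].
  have [k Dk] := FD i j x y Di Dj; have := infF k (x + y) Dk.
  lra.
rewrite -ler_pdivrMl//; apply: lb_le_inf => // _ [i Di <-].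
rewrite ler_pdivrMl//; have [k Dk] := FZ i t x Di t0.
exact/le_trans/infF.
Qed.

Lemma minimal_sublinear p : sublinear p ->
  exists q, [/\ sublinear q, forall x, q x <= p x &
    forall q', sublinear q' -> (forall x, q' x <= q x) -> q' = q].
Proof.
move=> sp; pose P q := sublinear q /\ forall x, q x <= p x; pose T := {q | P q}.
pose below (q q' : T) := `[< forall x, sval q' x <= sval q x >].
have [|||A Atot|[q [sq qp]] qmin] := @Zorn T below.
- by move=> q; apply/asboolP => x.
- move=> q1 q2 q3 /asboolP q12 /asboolP q23; apply/asboolP => x.
  exact: le_trans (q23 x) (q12 x).
- move=> [q1 h1] [q2 h2] /asboolP/= q12 /asboolP/= q21.
  apply/eq_exist/funext => x; by apply/le_anti; rewrite q12 q21.
- have [->|/set0P[q0 Aq0]] := eqVneq A set0.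
    by exists (exist P p (conj sp (fun=> lexx _))).
  have lb x : has_lbound [set sval q x | q in A].
    exists (- p (- x)) => _ [[q [sq qp]] _ <-]/=.
    by apply: le_trans (sublinear_ge x sq); rewrite lerN2.
  have si : sublinear (fun x => inf [set sval q x | q in A]).
    apply: sublinear_inf => //; first by exists q0.
      move=> q1 q2 x y A1 A2.
      have [/asboolP q12|/asboolP q21] := Atot _ _ A1 A2.
        exists q2 => //; apply: le_trans ((svalP q2).1.1 x y) _.
        by rewrite lerD2r.
      exists q1 => //; apply: le_trans ((svalP q1).1.1 x y) _.
      by rewrite lerD2l.
    by move=> q t x Aq t0; exists q => //; exact: (svalP q).1.2.
  have le_q (q : T) x : A q -> inf [set sval q x | q in A] <= sval q x.
    by move=> Aq; apply: ge_inf => //; exists q.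
  have ip x : inf [set sval q x | q in A] <= p x.
    exact: le_trans (le_q q0 x Aq0) ((svalP q0).2 x).
  by exists (exist P _ (conj si ip)) => q Aq; apply/asboolP => x; exact: le_q.
exists q; split => // q' sq' q'q.
have q'p x : q' x <= p x := le_trans (q'q x) (qp x).
have /(_ _)/(congr1 sval) := qmin (exist P q' (conj sq' q'p)).
by apply; apply/asboolP.
Qed.

(** The functional [q'] is the infimum of [q (x + t y) - t q y] over [t >= 0];
    it takes opposite values at [y] and [- y]. *)
Lemma straighten q y : sublinear q ->
  exists q', [/\ sublinear q', forall x, q' x <= q x & q' (- y) <= - q y].
Proof.
move=> sq; pose F (t : R) x := q (x + t *: y) - t * q y.
have lb x t : 0 <= t -> - q (- x) <= F t x.
  move=> t0; rewrite /F; have := sq.1 (x + t *: y) (- x).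
  have ty : t * q y <= q (t *: y).
    move: t0; rewrite le_eqVlt => /predU1P[<-|t0].
      by rewrite mul0r scale0r sublinear0.
    have := sq.2 t^-1 (t *: y); rewrite invr_gt0 => /(_ t0).
    by rewrite scalerA mulVf ?gt_eqF// scale1r -ler_pdivlMl ?invr_gt0// invrK.
  have -> : x + t *: y - x = t *: y by rewrite addrAC subrr add0r.
  lra.
have hlb x : has_lbound [set F t x | t in [set t | 0 <= t]].
  by exists (- q (- x)) => _ [t t0 <-]; exact: lb.
have le_F t x : 0 <= t -> inf [set F t x | t in [set t | 0 <= t]] <= F t x.
  by move=> t0; apply: ge_inf => //; exists t.
exists (fun x => inf [set F t x | t in [set t | 0 <= t]]); split.
- apply: sublinear_inf => //; first by exists 0 => /=.
    move=> t t' x x' /= t0 t'0; exists (t + t'); rewrite /= ?addr_ge0//.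
    rewrite /F scalerDl mulrDl; have := sq.1 (x + t *: y) (x' + t' *: y).
    rewrite addrACA; lra.
  move=> t r x /= t0 r0; exists (r * t); first by rewrite /= mulr_ge0// ltW.
  rewrite /F -scalerA -scalerDr; have := sq.2 r (x + t *: y) r0.
  by rewrite mulrBr mulrA; lra.
- move=> x; apply: le_trans (le_F 0 x (lexx _)) _.
  by rewrite /F scale0r addr0 mul0r subr0.
- apply: le_trans (le_F 1 (- y) ler01) _.
  by rewrite /F scale1r addNr mul1r sublinear0// sub0r.
Qed.

(** A minimal sublinear functional below [p] cannot be lowered by
    [straighten], so it is odd, and an odd sublinear functional is linear.
    Straightening [p] along [x0] beforehand makes it reach [p x0]. *)
Theorem hahn_banach p x0 : sublinear p ->
  exists u, [/\ {morph u : x y / x + y}, forall t x, u (t *: x) = t * u x,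
    forall x, u x <= p x & u x0 = p x0].
Proof.
move=> sp; have [p' [sp' p'p p'x0]] := straighten x0 sp.
have [u [su up' umin]] := minimal_sublinear sp'.
have uN x : u (- x) = - u x.
  have [q [sq qu qx]] := straighten x su.
  have ux : u (- x) <= - u x by rewrite -{1}(umin q sq qu).
  by apply/le_anti; rewrite ux lerNl sublinear_ge.
have uZ t x : 0 < t -> u (t *: x) = t * u x.
  move=> t0; apply/le_anti; rewrite su.2//=.
  by have := su.2 t (- x) t0; rewrite scalerN !uN mulrN lerN2.
exists u; split.
- move=> x y; apply/le_anti; rewrite su.1/=.
  by have := su.1 (- x) (- y); rewrite -opprD !uN -opprD lerN2.
- move=> t x; have [t0|t0|->] := ltgtP t 0.
  + by rewrite -[t]opprK scaleNr mulNr uN uZ// oppr_gt0.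
  + exact: uZ.
  + by rewrite scale0r mul0r sublinear0.
- by move=> x; apply: le_trans (up' x) (p'p x).
- apply/le_anti; rewrite (le_trans (up' x0) (p'p x0))/=.
  by have := le_trans (up' (- x0)) p'x0; rewrite uN lerN2.
Qed.

End hahn_banach.

(** * Real parts of functionals *)

Section real_norm.
Context {R : realType} {s : scalar_kind}.
Local Notation K := (scalar_field R s).
Context {X : normedModType K}.
Implicit Types (x y : X) (k : K).

Definition nrm x : R := re `|x|.

Lemma of_real_nrm x : of_real (nrm x) = `|x|.
Proof. by rewrite /nrm re_ge0K. Qed.

Lemma nrm_ge0 x : 0 <= nrm x.
Proof. by rewrite -(ler_of_real (s := s)) of_real0 of_real_nrm. Qed.

Lemma nrm_le x r : (nrm x <= r) = (`|x| <= of_real r).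
Proof. by rewrite -of_real_nrm ler_of_real. Qed.

Lemma nrm_lt x r : (nrm x < r) = (`|x| < of_real r).
Proof. by rewrite -of_real_nrm ltr_of_real. Qed.

Lemma nrmD x y : nrm (x + y) <= nrm x + nrm y.
Proof. by rewrite nrm_le of_realD !of_real_nrm ler_normD. Qed.

Lemma nrmN x : nrm (- x) = nrm x.
Proof. by rewrite /nrm normrN. Qed.

Lemma nrmB x y : nrm (x - y) = nrm (y - x).
Proof. by rewrite /nrm distrC. Qed.

Lemma nrm0 : nrm 0 = 0.
Proof. by rewrite /nrm normr0 re0. Qed.

Lemma nrmZ k x : nrm (k *: x) = re `|k| * nrm x.
Proof. by rewrite /nrm normrZ -{1}(of_real_re_norm k) re_realM. Qed.

Lemma nrmZ_real r x : nrm (of_real r *: x) = `|r| * nrm x.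
Proof. by rewrite nrmZ norm_of_real re_of_real. Qed.

Lemma nrm_phase n x : nrm (phase ^+ n *: x) = nrm x.
Proof. by rewrite nrmZ norm_phase re1 mul1r. Qed.

Lemma cvg_nrmP (f : nat -> X) x : f @ \oo --> x <->
  forall e : R, 0 < e -> exists N, forall n, (N <= n)%N -> nrm (x - f n) < e.
Proof.
split=> [/cvgrPdist_lt fx e e0|fx].
  have : 0 < of_real e :> K by rewrite -of_real0 ltr_of_real.
  by move=> /fx[N _ fN]; exists N => n Nn; rewrite nrm_lt; exact: fN.
apply/cvgrPdist_lt => e e0; have [|N fN] := fx (re e).
  by rewrite -(ltr_of_real (s := s)) of_real0 re_ge0K// ltW.
exists N => // n /= Nn; have := fN n Nn; rewrite nrm_lt re_ge0K//.
exact: ltW.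
Qed.

End real_norm.

Section functionals.
Context {R : realType} {s : scalar_kind}.
Local Notation K := (scalar_field R s).
Context {X : normedModType K}.
Implicit Types (x y : X) (u : X -> R).

Lemma unit_ball_nrm (Y : completeNormedModType K) (x : Y) :
  unit_ball x = (nrm x <= 1) :> Prop.
Proof. by rewrite nrm_le of_real1. Qed.

Definition real_linear u :=
  {morph u : x y / x + y} /\ forall t x, u (of_real t *: x) = t * u x.

(** These are the real parts of the functionals in the dual unit ball. *)
Definition dual_ball u := real_linear u /\ forall x, u x <= nrm x.

Lemma real_linear0 u : real_linear u -> u 0 = 0.
Proof. by move=> [_ uZ]; have := uZ 0 0; rewrite scaler0 mul0r. Qed.

Lemma real_linearN u x : real_linear u -> u (- x) = - u x.
Proof.
move=> [_ uZ]; have := uZ (-1) x.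
by rewrite of_realN of_real1 scaleN1r mulN1r.
Qed.

Lemma real_linearB u x y : real_linear u -> u (x - y) = u x - u y.
Proof. by move=> ul; rewrite ul.1 real_linearN. Qed.

Lemma real_linear_sum u I (r : seq I) (P : pred I) (F : I -> X) :
  real_linear u -> u (\sum_(i <- r | P i) F i) = \sum_(i <- r | P i) u (F i).
Proof. by move=> ul; apply: big_morph; [exact: ul.1|exact: real_linear0]. Qed.

Lemma dual_ball_norm u x : dual_ball u -> `|u x| <= nrm x.
Proof.
move=> [ul u1]; rewrite ler_norml u1 andbT lerNl -real_linearN//.
by rewrite -[leRHS]nrmN.
Qed.

(** The imaginary unit, or 0 over the reals: with this convention one formula
    recovers a scalar functional from its real part in both cases. *)
Definition imag : K :=
  match s return scalar_field R s with
  | RealScalars => 0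
  | ComplexScalars => 'i%C
  end.

Definition im (z : K) : R :=
  match s return scalar_field R s -> R with
  | RealScalars => fun=> 0
  | ComplexScalars => fun z : R[i] => complex.Im z
  end z.

Lemma re_imE (z : K) : z = of_real (re z) + imag * of_real (im z).
Proof.
move: z; rewrite /re /im /imag /of_real; case: s => [z|z].
  by rewrite mul0r addr0.
by rewrite [LHS]complexE.
Qed.

Lemma re_imag a : re (imag * of_real a) = 0.
Proof.
rewrite /re /imag /of_real; case: s => /=; first by rewrite mul0r.
by rewrite mul0r mulr0 subr0.
Qed.

Lemma imag_sqr : imag = 0 \/ imag * imag = -1.
Proof.
rewrite /imag; case: s; [by left|right]; exact: sqr_i.
Qed.

Lemma norm_imag : `|imag| <= 1.
Proof.
rewrite /imag; case: s; first by rewrite normr0 ler01.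
by rewrite normc_def/= expr0n add0r expr1n sqrtr1.
Qed.

(** The functional is [u x - i u (i x)], bounded by [2 C]. *)
Lemma re_functional u C :
  real_linear u -> (forall x, `|u x| <= C * nrm x) ->
  exists2 f : {linear X -> K^o}, continuous f & forall x, re (f x) = u x.
Proof.
move=> ul uC; have [uD uZ] := ul.
pose f : X -> K^o := fun x => of_real (u x) - imag * of_real (u (imag *: x)).
have fD x y : f (x + y) = f x + f y.
  by rewrite /f scalerDr !uD !of_realD mulrDr opprD addrACA.
have fZ t x : f (of_real t *: x) = of_real t * f x.
  rewrite /f scalerA [imag * of_real t]mulrC -scalerA !uZ !of_realM mulrBr.
  by congr (_ - _); exact: mulrCA.
have fi x : f (imag *: x) = imag * f x.
  rewrite /f; have [->|i2] := imag_sqr.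
    by rewrite !mul0r !scale0r real_linear0// of_real0 subr0.
  rewrite scalerA mulrBr mulrA i2 scaleN1r real_linearN// of_realN.
  by rewrite mulrN opprK mulN1r opprK addrC.
have lf : linear f.
  move=> k x y; rewrite fD [in LHS](re_imE k) scalerDl fD -scalerA fi !fZ.
  by rewrite mulrA -mulrDl -re_imE.
pose F : {linear X -> K^o} := HB.pack f (GRing.isLinear.Build _ _ _ _ f lf).
exists F; last by move=> x; rewrite /= /f reD reN re_imag subr0 re_of_real.
apply: bounded_linear_continuous; apply/linear_boundedP.
exists (of_real (C + C)); split.
  by rewrite realE -of_real0 !ler_of_real le_total.
move=> r Cr x; apply: (@le_trans _ _ (of_real (C + C) * `|x|)); last first.
  by rewrite ler_wpM2r// ltW.
rewrite /= /f (le_trans (ler_normB _ _))// of_realD mulrDl lerD//.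
  by rewrite norm_of_real -of_real_nrm -of_realM ler_of_real.
rewrite normrM (le_trans (ler_wpM2r _ norm_imag))// mul1r norm_of_real.
rewrite -of_real_nrm -of_realM ler_of_real (le_trans (uC _))//.
have [C0|C0] := lerP 0 C.
  rewrite ler_wpM2l// nrm_le of_real_nrm normrZ.
  by rewrite (le_trans (ler_wpM2r _ norm_imag))// mul1r.
(* A negative bound forces the whole space to be zero. *)
have x0 y : nrm y <= 0.
  by have := le_trans (normr_ge0 _) (uC y); rewrite nmulr_rge0.
have n0 y : nrm y = 0 by apply/le_anti; rewrite x0 nrm_ge0.
by rewrite !n0.
Qed.

End functionals.

Section realification.
Context {R : realType} {s : scalar_kind}.
Context (X : normedModType (scalar_field R s)).

(** The same space with scalars restricted to [R]. *)
Definition realification : Type := X.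
HB.instance Definition _ := GRing.Zmodule.on realification.

Let scale (r : R) (x : realification) : realification := of_real r *: (x : X).

Let scaleA a b v : scale a (scale b v) = scale (a * b) v.
Proof. by rewrite /scale scalerA of_realM. Qed.
Let scale1 : left_id 1 scale.
Proof. by move=> x; rewrite /scale of_real1 scale1r. Qed.
Let scaleDr : right_distributive scale +%R.
Proof. by move=> a x y; rewrite /scale scalerDr. Qed.
Let scaleDl v : {morph scale^~ v : a b / a + b}.
Proof. by move=> a b; rewrite /scale of_realD scalerDl. Qed.

HB.instance Definition _ := GRing.Zmodule_isLmodule.Build R realification
  scaleA scale1 scaleDr scaleDl.

Lemma norming_functional (x : X) :
  exists2 u : X -> R, dual_ball u & u x = nrm x.
Proof.
have sn : sublinear (nrm : realification -> R).
  split=> [y z|t y t0]; first exact: nrmD.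
  by rewrite nrmZ_real gtr0_norm.
have [u [uD uZ un ux]] := hahn_banach (x : realification) sn.
by exists u.
Qed.

End realification.

(** * Slices of the unit ball and norm-attaining functionals *)

Section slices.
Context {R : realType} {s : scalar_kind}.
Local Notation K := (scalar_field R s).
Context {X : completeNormedModType K}.
Implicit Types (x y a : X) (u : X -> R) (S B : set X).

Lemma unit_ball_phase n x : unit_ball x -> unit_ball (phase ^+ n *: x).
Proof. by rewrite !unit_ball_nrm nrm_phase. Qed.

Lemma unit_ballN x : unit_ball x -> unit_ball (- x).
Proof. by rewrite !unit_ball_nrm nrmN. Qed.

Lemma is_slice_opp S :
  is_slice unit_ball S -> is_slice unit_ball [set x | S (- x)].
Proof.
move=> [[x Sx] [f [al [cf al0 SE]]]]; split.
  by exists (- x); rewrite /= opprK.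
exists (\- f), al; split => //.
  by move=> y; apply: cvgN; exact: cf.
have supE : [set re (f b) | b in unit_ball] =
    [set re ((\- f) b) | b in (unit_ball : set X)].
  apply/seteqP; split=> _ [b bb <-]; exists (- b).
  - exact: unit_ballN.
  - by rewrite /= linearN opprK.
  - exact: unit_ballN.
  - by rewrite /= linearN.
rewrite SE; apply/seteqP.
split=> y; rewrite /slice /= -supE linearN => -[yb fy].
- by split=> //; rewrite -[y]opprK; exact: (unit_ballN yb).
- by split=> //; exact: (unit_ballN yb).
Qed.

Lemma sum_half n : \sum_(i < n) (2^-1 : R) ^+ i.+1 = 1 - 2^-1 ^+ n.
Proof.
elim: n => [|n IH]; first by rewrite big_ord0 expr0 subrr.
by rewrite big_ord_recr/= IH exprS; lra.
Qed.

Lemma half_lt (e : R) : 0 < e ->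
  exists N, forall n, (N <= n)%N -> (2^-1 : R) ^+ n < e.
Proof.
move=> e0; have h : `|2^-1 : R| < 1 by rewrite ger0_norm; lra.
have /cvgrPdist_lt/(_ _ e0)[N _ Nn] := cvg_expr h.
by exists N => n /Nn; rewrite sub0r normrN ger0_norm// exprn_ge0//; lra.
Qed.

Definition slices_reach_sphere := forall C : set X,
  is_convex_series_of_slices unit_ball C -> C `&` unit_sphere !=set0.

(** A norming functional of a point of the sphere in the convex series with
    weights [2^-(n+1)] must be 1 at every term of the series. *)
Theorem slices_common_functional : slices_reach_sphere ->
  forall S : nat -> set X, (forall n, is_slice unit_ball (S n)) ->
  exists2 u, dual_ball u & forall n, exists2 x, S n x & u x = 1.
Proof.
move=> hX S slS.
pose w i : R := 2^-1 ^+ i.+1.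
have w0 i : 0 < w i by rewrite exprn_gt0//; lra.
have ball i x : S i x -> unit_ball x.
  by have [_ [f [al [_ _ ->]]]] := slS i; case.
have [|z [[y [Sy yz]] z1]] := hX [set x | exists y : nat -> X,
    (forall i, S i (y i)) /\
    series (fun i => (of_real (w i) : K) *: y i) @ \oo --> x].
  exists (fun i => of_real (w i)), S; split => //.
    by move=> i; rewrite -of_real0 ler_of_real ltW.
  apply/(cvg_nrmP (X := K^o)) => e /half_lt[N Ne].
  exists N => n /Ne; rewrite /series/= big_mkord.
  have -> : \sum_(i < n) (of_real (w i) : K) = of_real (1 - 2^-1 ^+ n).
    by rewrite -sum_half (big_morph _ of_realD of_real0).
  rewrite -of_real1 -of_realN -of_realD opprB addrC subrK.
  rewrite /nrm norm_of_real re_of_real.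
  by rewrite ger0_norm// exprn_ge0//; lra.
have {}z1 : nrm z = 1 by rewrite /nrm z1 re1.
have [u ub uz] := norming_functional z.
exists u => // k; exists (y k) => //; have [[uD uZ] un] := ub.
have uy i : u (y i) <= 1.
  by apply: le_trans (un _) _; rewrite -unit_ball_nrm; exact: ball (Sy i).
apply/le_anti; rewrite uy/= leNgt; apply/negP => yk1.
(* The deficit at index [k] would keep [u] of all later partial sums below
   [1 - d], hence away from [u z = 1]. *)
pose d := w k * (1 - u (y k)).
have d0 : 0 < d by rewrite mulr_gt0// subr_gt0.
move/cvg_nrmP : yz => /(_ _ d0)[N Nd].
pose n := (N + k.+1)%N.
have := Nd n (leq_addr _ _); apply/negP; rewrite -leNgt.
apply: le_trans (un _); rewrite real_linearB// uz z1 /series/= big_mkord.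
rewrite real_linear_sum//.
suff : \sum_(i < n) u (of_real (w i) *: y i) <= \sum_(i < n) w i - d.
  rewrite sum_half; have : (0 : R) <= 2^-1 ^+ n by rewrite exprn_ge0//; lra.
  lra.
have kn : (k < n)%N by rewrite /n addnS ltnS leq_addl.
rewrite (bigD1 (Ordinal kn))//= [X in _ <= X - _](bigD1 (Ordinal kn))//=.
rewrite uZ /d mulrBr mulr1.
rewrite [leRHS](_ : _ = w k * u (y k) + \sum_(i < n | i != Ordinal kn) w i).
  rewrite lerD2l; by apply: ler_sum => i _; rewrite uZ ler_piMr// ltW.
by ring.
Qed.

Lemma conv_of_real (a b : convex_lmodType X) (k : {i01 K}) :
  exists t, [/\ 0 <= t, t <= 1 &
    conv k a b = of_real t *: (a : X) + of_real (1 - t) *: (b : X) :> X].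
Proof.
have kE : of_real (re k%:num) = k%:num by rewrite re_ge0K.
exists (re k%:num); split.
- by rewrite -(ler_of_real (s := s)) of_real0 kE.
- by rewrite -(ler_of_real (s := s)) of_real1 kE.
- by rewrite of_realD of_realN of_real1 kE.
Qed.

Lemma convex_hull_ge u B : real_linear u -> (forall x, B x -> 1 <= u x) ->
  forall x, convex_hull B x -> 1 <= u x.
Proof.
move=> [uD uZ] uB x /(_ [set x | 1 <= u x]); apply; split=> // a b k.
have [t [t0 t1 ->]] := conv_of_real a b k; rewrite !inE/= => ua ub.
rewrite uD !uZ; nra.
Qed.

Lemma closed_convex_hull_ge u B : dual_ball u -> (forall x, B x -> 1 <= u x) ->
  forall x, closed_convex_hull B x -> 1 <= u x.
Proof.
move=> ub uB x cx; apply/ler_addgt0Pr => e e0.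
have /cx[y [hy /= xy]] : nbhs x [set y | nrm (x - y) < e].
  apply/nbhs_normP; exists (of_real e).
    by rewrite /= -of_real0 ltr_of_real.
  by move=> y; rewrite /= nrm_lt.
have := convex_hull_ge ub.1 uB hy; have := ub.2 (y - x).
rewrite real_linearB; last exact: ub.1.
by rewrite nrmB; lra.
Qed.

(** A determining sequence of slices together with its mirror image would
    force a functional to take at the determined point both a value at least 1
    and a value at most -1. *)
Theorem SCD_unit_ball : slices_reach_sphere -> SCD (unit_ball : set X) = set0.
Proof.
move=> hX; rewrite -subset0 => a [_ [V [slV [_ detV]]]].
pose S n := if odd n then [set x | V n./2 (- x)] else V n./2.
have [|u ub uS] := slices_common_functional hX (S := S).
  by move=> n; rewrite /S; case: ifP => _ //; exact: is_slice_opp.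
have inball n x : V n x -> unit_ball x.
  by have [_ [f [al [_ _ ->]]]] := slV n; case.
pose P n x := V n x /\ u x = 1; pose N n x := V n x /\ u x = -1.
have VP n : exists x, P n x.
  by have [x] := uS n.*2; rewrite /S odd_double doubleK => Vx ux; exists x.
have VN n : exists x, N n x.
  have [x] := uS n.*2.+1; rewrite /S/= odd_double/= uphalf_double => Vx ux.
  exists (- x).
  by split=> //; rewrite real_linearN ?ux//; exact: ub.1.
have sub (F : nat -> X -> Prop) : (forall n x, F n x -> V n x) ->
    (forall n, exists x, F n x) ->
    closed_convex_hull [set x | exists n, F n x] a.
  move=> FV Fx; apply: detV => [x [n /FV/inball//]|n].
  by have [x Fnx] := Fx n; exists x; split; [exists n|exact: FV].
have ua : 1 <= u a.
  apply: (closed_convex_hull_ge ub) (sub P _ VP); first by move=> x [n [_ ->]].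
  by move=> n x [].
have nb : dual_ball (fun x => - u x).
  split; first by split=> [x y|t x]; rewrite (ub.1.1, ub.1.2) (opprD, mulrN).
  by move=> x; apply: le_trans (ler_norm _) _; rewrite normrN dual_ball_norm.
have una : 1 <= - u a.
  apply: (closed_convex_hull_ge nb) (sub N _ VN).
    by move=> x [n [_ ->]]; rewrite opprK.
  by move=> n x [].
lra.
Qed.

Lemma SCD_set_SCD A a : SCD_set A -> A a -> SCD A a.
Proof.
move=> [V [slV VA]] Aa; split => //; exists V; split => //; split.
  move=> n; split; first exact: (slV n).1.
  by have [_ [f [al [_ _ ->]]]] := slV n => x [].
by move=> B BA BV; exact: VA.
Qed.

Theorem not_SCD_space : slices_reach_sphere -> ~ SCD_space X.
Proof.
move=> hX scdX; suff : SCD (unit_ball : set X) 0 by rewrite SCD_unit_ball.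
have b0 : unit_ball (0 : X) by rewrite unit_ball_nrm nrm0.
apply: SCD_set_SCD => //; apply: scdX; first by exists 0.
  exists 1; split; first exact: real1.
  by move=> r r1 x /= xb; rewrite (le_trans xb)// ltW.
move=> x y k; have [t [t0 t1 ->]] := conv_of_real x y k.
rewrite !inE !unit_ball_nrm => xb yb; apply: le_trans (nrmD _ _) _.
have t1' : 0 <= 1 - t by lra.
rewrite !nrmZ_real !ger0_norm//; nra.
Qed.

End slices.

(** * Uncountable families of functionals resembling the basis of l1 *)

Section free_families.
Context {R : realType} {s : scalar_kind}.
Local Notation K := (scalar_field R s).
Context {X : completeNormedModType K}.
Implicit Types (x y : X) (u v : X -> R) (G : set (X -> R)).

(** A version, for the finite group of phases, of isometric equivalence with
    the unit vector basis of l1(G): the norm of a sum of members of [G] rotated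
    by phases is the number of summands. The phase is a function of the member,
    so that repetitions in the list are harmless. *)
Definition phase_free G := G `<=` dual_ball /\
  forall (p : (X -> R) -> nat) (l : seq (X -> R)) (e : R),
    (forall v, v \in l -> G v) -> 0 < e ->
    exists2 x, unit_ball x & forall v, v \in l -> 1 - e < v (phase ^+ p v *: x).

Lemma ler_sum_size (T : eqType) (l : seq T) (h : T -> R) c :
  (forall i, i \in l -> h i <= c) -> \sum_(i <- l) h i <= (size l)%:R * c.
Proof.
elim: l => [|i l IH] hc; first by rewrite big_nil mul0r.
rewrite big_cons /= -natr1 mulrDl mul1r addrC lerD ?hc ?mem_head//.
by apply: IH => j jl; rewrite hc// inE jl orbT.
Qed.

Lemma real_linear_phase u n : real_linear u ->
  real_linear (fun x => u (phase ^+ n *: x)).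
Proof.
move=> [uD uZ]; split=> [x y|t x]; first by rewrite scalerDr uD.
by rewrite scalerA mulrC -scalerA uZ.
Qed.

Lemma dual_ball_le1 u n x :
  dual_ball u -> unit_ball x -> u (phase ^+ n *: x) <= 1.
Proof.
move=> [_ un]; rewrite unit_ball_nrm => x1.
by rewrite (le_trans (un _))// nrm_phase.
Qed.

(** The slice is cut out by the sum [U] of the rotated members of [l]. Its
    supremum over the ball is the length of [l], and each of its summands is at
    most 1, so where [U] is within [e] of its supremum every summand is within
    [e] of 1. *)
Lemma phase_free_slice G (p : (X -> R) -> nat) (l : seq (X -> R)) e :
  phase_free G -> (forall v, v \in l -> G v) -> 0 < e ->
  exists2 S : set X, is_slice unit_ball S &
    forall x, S x ->
      unit_ball x /\ forall v, v \in l -> 1 - e < v (phase ^+ p v *: x).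
Proof.
move=> [Gb Gf] lG e0.
pose U x := \sum_(v <- l) v (phase ^+ p v *: x).
have lb v : v \in l -> dual_ball v by move=> /lG/Gb.
have Ul : real_linear U.
  split=> [x y|t x]; rewrite /U.
    rewrite -big_split; apply: eq_big_seq => v /lb[vl _].
    exact: (real_linear_phase _ vl).1.
  rewrite mulr_sumr; apply: eq_big_seq => v /lb[vl _].
  exact: (real_linear_phase _ vl).2.
have Ub x : `|U x| <= (size l)%:R * nrm x.
  rewrite (le_trans (ler_norm_sum _ _ _))//; apply: ler_sum_size => v /lb vb.
  by rewrite (le_trans (dual_ball_norm _ vb))// nrm_phase.
have [f cf fU] := re_functional Ul Ub.
have U1 x : unit_ball x -> U x <= (size l)%:R.
  move=> xb; rewrite -[leRHS]mulr1; apply: ler_sum_size => v /lb vb.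
  exact: dual_ball_le1.
have fUE : [set re (f b) | b in unit_ball] = U @` unit_ball.
  by apply: eq_imagel => x _; exact: fU.
have ubU : ubound (U @` unit_ball) (size l)%:R by move=> _ [x xb <-]; exact: U1.
have U_near d : 0 < d -> exists2 x, unit_ball x & (size l)%:R - d < U x.
  move=> d0; have [|x xb xl] := Gf p l (d / (size l).+1%:R) lG.
    by rewrite divr_gt0.
  have : \sum_(v <- l) - v (phase ^+ p v *: x) <=
      (size l)%:R * - (1 - d / (size l).+1%:R).
    by apply: ler_sum_size => v /xl vl; rewrite lerN2 ltW.
  rewrite sumrN mulrN lerN2 mulrBr mulr1 => Ux; exists x => //.
  apply: lt_le_trans Ux; rewrite ltrD2l ltrN2 mulrCA gtr_pMr//.
  by rewrite ltr_pdivrMr// mul1r ltr_nat.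
have supE : sup (U @` unit_ball) = (size l)%:R.
  apply/le_anti/andP; split.
    apply: ge_sup => //; exists (U 0), 0 => //.
    by rewrite unit_ball_nrm nrm0.
  apply/ler_addgt0Pr => d /U_near[x xb xd].
  rewrite -lerBlDr (le_trans (ltW xd))//; apply: ub_le_sup.
    by exists (size l)%:R.
  by exists x.
exists (slice unit_ball f e).
  split; last by exists f, e.
  by have [x xb xe] := U_near e e0; exists x; split => //; rewrite fUE supE fU.
move=> x [xb]; rewrite fUE supE fU => xe; split=> // v vl.
rewrite ltNge; apply/negP => ve; move: xe; apply/negP; rewrite -leNgt.
rewrite /U (big_rem v vl)/=.
have : \sum_(w <- rem v l) w (phase ^+ p w *: x) <= (size (rem v l))%:R * 1.
  by apply: ler_sum_size => w /mem_rem/lb wb; exact: dual_ball_le1.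
have : (size l)%:R = (size (rem v l))%:R + 1 :> R.
  by rewrite size_rem// natr1 prednK//; case: (l) vl.
lra.
Qed.

(** The finitely many conditions on a list of members of [G] are coded by
    natural numbers through an injection [c] of [G], so the slices of
    [phase_free_slice] with margins [1/(m+1)] form a sequence. A functional [u]
    equal to 1 somewhere in each of them lies outside [G]: on one of these
    slices a given member of [G] is negative. *)
Lemma phase_free_extend G :
  slices_reach_sphere (X := X) -> phase_free G -> countable G ->
  exists2 g, ~ G g & phase_free (g |` G).
Proof.
move=> hX Gfree /countable_injP[c cinj]; have [Gb Gf] := Gfree.
pose target (d : nat * seq (nat * nat)) := [set x | unit_ball x /\
  forall v k, G v -> (c v, k) \in d.2 ->
    1 - d.1.+1%:R^-1 < v (phase ^+ k *: x)].
(* Codes of conditions that no slice fulfils are assigned the whole ball. *)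
have [|u ub uS] := slices_common_functional hX (S := fun n =>
    if pselect (exists2 S, is_slice unit_ball S &
      S `<=` target (odflt (0%N, [::]) (unpickle n)))
    is left h then sval (cid2 h) else unit_ball).
  move=> n; case: pselect => [h|_]; first by case: cid2.
  have b0 : unit_ball (0 : X) by rewrite unit_ball_nrm nrm0.
  split; first by exists 0.
  have z (x : X) : re ((\0 : {linear X -> K^o}) x) = 0 by exact: re0.
  exists \0, 1; split => //; first exact: cst_continuous.
  apply/seteqP; split=> x; rewrite /slice/=; last by case.
  move=> xb; split => //; rewrite (_ : [set re _ | _ in _] = [set 0]).
    by rewrite sup1 (z x); lra.
  apply/seteqP; split=> [_ [y _ <-]|_ ->]; first exact: z.
  by exists 0 => //; exact: z.
have key (p : (X -> R) -> nat) (l : seq (X -> R)) e :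
    (forall v, v \in l -> G v) -> 0 < e -> exists x, [/\ unit_ball x, u x = 1 &
      forall v, v \in l -> 1 - e < v (phase ^+ p v *: x)].
  move=> lG e0; pose m := Num.truncn e^-1.
  have me : m.+1%:R^-1 <= e.
    by rewrite -[leRHS]invrK lef_pV2 ?posrE ?invr_gt0// ltW// truncnS_gt.
  pose d := (m, [seq (c v, p v) | v <- l]).
  have := uS (pickle d); rewrite pickleK/=; case: pselect => [h|[]]; last first.
    have [|S slS ST] := phase_free_slice (e := m.+1%:R^-1) p Gfree lG.
      by rewrite invr_gt0.
    exists S => // x /ST[xb xl]; split=> // v k Gv /mapP[w wl [cvw ->]].
    have vw : v = w by apply: cinj => //; rewrite inE//; exact: lG.
    by rewrite vw; exact: xl.
  case: cid2 => /= S slS ST [x /ST[xb xl] ux]; exists x; split=> // v vl.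
  apply: le_lt_trans (xl v (p v) (lG v vl) (map_f (fun v => (c v, p v)) vl)).
  by rewrite lerB.
have phaseV n x : phase ^+ n *: (phase ^+ (3 * n) *: x) = x.
  by rewrite scalerA -exprD -mulSn exprM phase4 expr1n scale1r.
exists u.
  move=> Gu; have [n n1] := @phase_opp R s.
  have [||x [_ ux]] := key (fun=> n) [:: u] 1; rewrite //.
    by move=> v; rewrite inE => /eqP ->.
  move=> /(_ u (mem_head _ _)).
  rewrite n1 scaleN1r real_linearN ?ux; last exact: ub.1.
  by rewrite subrr ltrNr oppr0 ltr10.
split=> [v [->//|/Gb//]|p l e lG e0].
(* The point found has phase 1 for [u]; rotating it by the inverse of the
   phase of [u] changes all other phases, which is compensated in advance. *)
have [||x [xb ux xl]] :=
  key (fun v => p v + 3 * p u)%N [seq v <- l | v != u] e; rewrite //.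
  by move=> v; rewrite mem_filter => /andP[vu /lG[/eqP|//]]; rewrite (negPf vu).
exists (phase ^+ (3 * p u) *: x); first exact: unit_ball_phase.
move=> v vl; have [->|vu] := eqVneq v u.
  by rewrite phaseV ux ltrBlDr ltrDl.
by rewrite scalerA -exprD; apply: xl; rewrite mem_filter vu.
Qed.

Lemma phase_free_uncountable : slices_reach_sphere (X := X) ->
  exists2 G, phase_free G & ~ countable G.
Proof.
move=> hX; have [F FP Ftot|G [Gf Gmax]] := @Zorn_bigcup (X -> R) phase_free.
  split=> [v [G /FP[Gb _]]|p l e lF e0]; first exact: Gb.
  have [->|[G FG Gl]] : l = [::] \/ exists2 G, F G & forall v, v \in l -> G v.
    elim: l lF => [|v l IH] lF; [by left|right].
    have [G FG Gv] : (\bigcup_(G in F) G) v by apply: lF; rewrite mem_head.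
    have [|l0|[G' FG' Gl]] := IH.
    - by move=> w wl; apply: lF; rewrite inE wl orbT.
    - by exists G => // w; rewrite l0 inE => /eqP ->.
    have [GG'|G'G] := Ftot _ _ FG FG'.
      by exists G' => // w; rewrite inE => /predU1P[->|/Gl//]; exact: GG'.
    by exists G => // w; rewrite inE => /predU1P[->//|/Gl]; exact: G'G.
  by exists 0 => //; rewrite unit_ball_nrm nrm0.
  exact: (FP _ FG).2.
exists G => // cG; have [g Gg gf] := phase_free_extend hX Gf cG.
apply: Gmax gf; split; first exact: subsetUr.
by move=> /(_ g (or_introl erefl)).
Qed.

End free_families.

(** * Independent points from an uncountable family *)

Section condensation.
Context {R : realType} {s : scalar_kind}.
Local Notation K := (scalar_field R s).
Context {X : completeNormedModType K}.
Implicit Types (x y : X) (u v : X -> R) (G W : set (X -> R)).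

Lemma dense_nrm (D : set X) x (e : R) : dense D -> 0 < e ->
  exists2 d, D d & nrm (x - d) < e.
Proof.
move=> dD e0; have oe : (0 : K) < of_real e by rewrite -of_real0 ltr_of_real.
have [|d [xd Dd]] := dD (ball x (of_real e)) _ (ball_open _ _).
  by exists x; exact: ballxx.
by exists d => //; rewrite nrm_lt; move: xd; rewrite -ball_normE.
Qed.

(** The exceptional [v] fail the property for some [x] and [q], which may be
    moved to a point [d] of a countable dense set and a rational [r]; each pair
    [(d, r)] accounts for countably many exceptions only. *)
Lemma condensation W : separable X -> W `<=` dual_ball -> ~ countable W ->
  exists2 W', ~ countable W' & W' `<=` [set v | W v /\
    forall x q, q < v x -> ~ countable [set w | W w /\ q < w x]].
Proof.
move=> [D cD dD] Wb cW.
pose C x q := [set w | W w /\ q < w x].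
pose N := \bigcup_(d in D) \bigcup_(q in [set: rat])
  [set v | C d (ratr q) v /\ countable (C d (ratr q))].
exists (W `\` N) => [cWN|v [Wv Nv]].
  apply: cW; apply: sub_countable (_ : countable (N `|` (W `\` N))).
    apply: subset_card_le => w Ww.
    by have [Nw|Nw] := pselect (N w); [left|right].
  rewrite -bigcup2E; apply: bigcup_countable => // -[|[|n]] _ //=.
  apply: bigcup_countable => // d Dd; apply: bigcup_countable => // q _.
  have [cC|cC] := pselect (countable (C d (ratr q))).
    by apply: sub_countable cC; apply: subset_card_le => w [].
  by rewrite (_ : [set _ | _] = set0)// -subset0 => w [].
split => // x q qv cC; apply: Nv.
pose e := (v x - q) / 4; have e0 : 0 < e by rewrite divr_gt0// subr_gt0.
have [d Dd xd] := dense_nrm x dD e0.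
have ve : v x - q = 4 * e by rewrite /e; lra.
have dist w : W w -> `|w x - w d| < e.
  move=> /Wb wb; rewrite -real_linearB; last exact: wb.1.
  exact: le_lt_trans (dual_ball_norm _ wb) xd.
have qe : q + e < q + 2 * e by lra.
have [r] := rat_in_itvoo qe; rewrite in_itv/= => /andP[r1 r2].
exists d => //; exists r => //; split.
  by split=> //; have := dist v Wv; rewrite ltr_norml => /andP[]; lra.
apply: sub_countable cC; apply: subset_card_le => w [Ww rw]; split=> //.
by have := dist w Ww; rewrite ltr_norml => /andP[]; lra.
Qed.

(** The values of [p] can be prescribed because the representatives [v i] are
    chosen distinct. *)
Lemma pick_labelled (T : choiceType) (I : eqType) (W : I -> set T)
    (k : I -> nat) (r : seq I) :
  (forall i, ~ countable (W i)) ->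
  exists (v : I -> T) (p : T -> nat),
    forall i, i \in r -> W i (v i) /\ p (v i) = k i.
Proof.
move=> cW; elim: r => [|a r [v [p vp]]].
  have pt i : exists t, W i t.
    apply/not_existsP => W0; apply: (cW i).
    by rewrite (_ : W i = set0)// -subset0.
  by exists (fun i => sval (cid (pt i))), (fun=> 0%N).
have [ar|ar] := boolP (a \in r).
  by exists v, p => i; rewrite inE => /predU1P[->|]; exact: vp.
have [t [Wt tr]] : exists t, W a t /\ t \notin map v r.
  apply: contrapT => Wr; apply: (cW a).
  apply: sub_countable (finite_set_countable (finite_seq (map v r))).
  apply: subset_card_le => t Wt; apply: contrapT => /negP tr.
  by apply: Wr; exists t.
exists (fun i => if i == a then t else v i).
exists (fun w => if w == t then k a else p w).
move=> i; rewrite inE; have [->|ia]/= := eqVneq i a; first by rewrite eqxx.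
move=> ir; have [Wi pi] := vp i ir; split=> //.
by case: eqVneq => // vit; move: tr; rewrite -vit map_f.
Qed.

(** Any bound above [7/8] in place of [15/16] would leave a positive constant
    in [dual_ball_rotated]. *)
Definition branch G (l : seq X) (sg : nat -> nat) : set (X -> R) :=
  [set v | G v /\ forall j, (j < size l)%N ->
     15 / 16 < v (phase ^+ sg j *: nth 0 l j)].

(** Each phase pattern [t] on [size l + 1] points selects a condensation point
    [v t] of the branch given by all but its last phase, these points being
    distinct for distinct [t]. One point [x] of the ball realises all the last
    phases at once, and condensation turns the single member [v t] into
    uncountably many. *)
Lemma branch_extend G (l : seq X) : separable X -> phase_free G ->
  (forall sg, ~ countable (branch G l sg)) ->
  exists2 x, unit_ball x & forall sg, ~ countable (branch G (rcons l x) sg).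
Proof.
move=> sX [Gb Gf] cG; pose n := size l.
pose I := {ffun 'I_n.+1 -> 'I_4}.
pose ext (t : I) j : nat := t (inord j).
have lb sg : branch G l sg `<=` dual_ball by move=> v [/Gb].
have cW (t : I) : ~ countable [set v | branch G l (ext t) v /\
    forall x q, q < v x ->
      ~ countable [set w | branch G l (ext t) w /\ q < w x]].
  have [W cW sW] := condensation sX (lb _) (cG (ext t)).
  by apply: contra_not cW; apply: sub_countable; exact: subset_card_le.
have [v [p vp]] := pick_labelled (fun t => ext t n) (enum I) cW.
have [||x xb xv] := Gf p [seq v t | t <- enum I] (1 / 16).
- by move=> _ /mapP[t /vp[[[Gv _] _] _] ->].
- by rewrite divr_gt0.
exists x => // sg; pose t : I := [ffun j : 'I_n.+1 => inord (sg j %% 4)].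
have phase_t j : (j <= n)%N -> phase ^+ ext t j = phase ^+ sg j :> K.
  have mod4 : (sg j %% 4 < 4)%N by rewrite ltn_mod.
  by move=> jn; rewrite /ext ffunE !inordK// expr_mod// phase4.
have tI : t \in enum I by rewrite mem_enum.
have [[_ vt] pt] := vp t tI.
have xt : 15 / 16 < v t (phase ^+ ext t n *: x).
  rewrite -pt; apply: le_lt_trans (xv (v t) (map_f v tI)); lra.
apply: contra_not (vt _ _ xt); apply: sub_countable; apply: subset_card_le.
move=> w [[Gw wl] wx]; split=> // j; rewrite size_rcons ltnS nth_rcons => jn.
rewrite -phase_t//; case: ltngtP jn => // [jn _|-> _]; first exact: wl.
exact: wx.
Qed.

Lemma phase_sequence G : separable X -> phase_free G -> ~ countable G ->
  exists x : nat -> X, (forall n, unit_ball (x n)) /\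
    forall (sg : nat -> nat) n, exists2 v, G v &
      forall j, (j < n)%N -> 15 / 16 < v (phase ^+ sg j *: x j).
Proof.
move=> sX fG cG.
pose ok (l : seq X) := (forall j, (j < size l)%N -> unit_ball (nth 0 l j)) /\
  forall sg, ~ countable (branch G l sg).
have ok0 : ok [::].
  split=> // sg; apply: contra_not cG; apply: sub_countable.
  by apply: subset_card_le => v Gv; split.
have ext (l : {l | ok l}) : {x | ok (rcons (sval l) x)}.
  case: l => l [lb cl] /=; apply: cid.
  have [x xb cx] := branch_extend sX fG cl; exists x; split=> // j.
  rewrite size_rcons ltnS nth_rcons => jn; case: ltngtP jn => // jn _.
  exact: lb.
pose next (l : {l | ok l}) : {l | ok l} := exist ok _ (svalP (ext l)).
pose st n := iter n next (exist ok [::] ok0).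
have sz n : size (sval (st n)) = n.
  by elim: n => // n IH; rewrite /= size_rcons IH.
have nthS j m : (j < m)%N -> nth 0 (sval (st m)) j = nth 0 (sval (st j.+1)) j.
  elim: m => // m IH; rewrite ltnS leq_eqVlt => /predU1P[->//|jm].
  by rewrite [LHS]nth_rcons sz jm IH.
exists (fun n => nth 0 (sval (st n.+1)) n); split=> [n|sg n].
  by apply: (svalP (st n.+1)).1; rewrite sz.
have [v [Gv vl]] : exists v, branch G (sval (st n)) sg v.
  apply: contrapT => nb; apply: ((svalP (st n)).2 sg).
  by rewrite (_ : branch _ _ _ = set0)// -subset0 => v bv; apply: nb; exists v.
exists v => // j jn; rewrite -(nthS j n jn); apply: vl.
by rewrite sz.
Qed.

End condensation.

(** * The isomorphic copy of l1 *)

Section l1_embedding.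
Context {R : realType} {s : scalar_kind}.
Local Notation K := (scalar_field R s).
Context {X : completeNormedModType K}.
Implicit Types (a b : nat -> K) (u v : X -> R).

(** For [|b| = 1], the point [y - (b/2) y] has norm at most [7/8], so
    [u (b y) >= 2 (15/16 - 7/8) = 1/8]. *)
Lemma dual_ball_rotated u y (b : K) :
  dual_ball u -> nrm y <= 1 -> 15 / 16 < u y -> re `|b| <= 2 * re b ->
  re `|b| <= 8 * u (b *: y).
Proof.
move=> [ul un] y1 uy bb.
have := re_norm_ge0 b; rewrite le_eqVlt => /predU1P[b0|b0].
  have -> : b = 0 by apply/normr0_eq0; rewrite -of_real_re_norm -b0 of_real0.
  by rewrite scale0r normr0 re0 real_linear0// mulr0.
pose c := re `|b|; pose b' := of_real c^-1 * b.
have cb : b = of_real c * b'.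
  by rewrite mulrA -of_realM mulfV ?gt_eqF// of_real1 mul1r.
have nb' : re `|b'| = 1.
  have ci : 0 <= c^-1 by rewrite invr_ge0 ltW.
  by rewrite /b' normrM norm_of_real re_realM (ger0_norm ci) mulVf// gt_eqF.
have rb' : 1 <= 2 * re b'.
  rewrite /b' re_realM mulrCA -ler_pdivrMl ?invr_gt0// invrK mulr1//.
have : u (y - of_real 2^-1 *: (b' *: y)) <= 7 / 8.
  apply: le_trans (un _) _.
  rewrite -[X in X - _]scale1r scalerA -scalerBl nrmZ.
  apply: le_trans (norm_sub_half nb' rb').
  by rewrite ler_piMr// re_norm_ge0.
rewrite real_linearB// ul.2 => ub'.
rewrite cb -scalerA ul.2 normrM norm_of_real re_realM nb' mulr1.
rewrite (ger0_norm (ltW b0)) -/c.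
rewrite mulrCA -[leLHS]mulr1 ler_pM2l//; lra.
Qed.

Section sequence.
Context (x : nat -> X) (xb : forall n, unit_ball (x n)).

Lemma l1_cvg a : l1 a -> exists2 L, l1_norm a = L%:E &
  series (fun n => re `|a n|) @ \oo --> L.
Proof.
move=> la; pose t n := re `|a n|.
have t0 n : 0 <= t n by exact: re_norm_ge0.
have e0 n : (0 <= (t n)%:E)%E by rewrite lee_fin.
have n0 : (0 <= l1_norm a)%E by apply: nneseries_ge0 => n _ _; exact: e0.
have fin : l1_norm a \is a fin_num by rewrite ge0_fin_numE.
have cv : cvgn (series t).
  apply: nondecreasing_is_cvgn; first exact: nondecreasing_series.
  exists (fine (l1_norm a)) => _ [n _ <-]; rewrite -lee_fin fineK//.
  rewrite /series /= -sumEFin; apply: nneseries_lim_ge => k _ _; exact: e0.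
exists (limn (series t)) => //.
rewrite /l1_norm -EFin_lim//; congr (limn _); apply/funext => n /=.
by rewrite /series/= sumEFin.
Qed.

Lemma nrm_sum_le a (r : seq nat) :
  nrm (\sum_(k <- r) a k *: x k) <= \sum_(k <- r) re `|a k|.
Proof.
elim: r => [|k r IH]; first by rewrite !big_nil nrm0.
rewrite !big_cons (le_trans (nrmD _ _))// lerD// nrmZ ler_piMr ?re_norm_ge0//.
by rewrite -unit_ball_nrm.
Qed.

Lemma l1_comb_cvg a : l1 a -> cvgn (series (fun n => a n *: x n)).
Proof.
move=> /l1_cvg[L _ cL].
have /cvgP/cauchy_cvgP/(@cauchy_seriesP R R^o) ct := cL.
apply/cauchy_cvgP/cauchy_seriesP => e e0.
have re0 : 0 < re e by rewrite -(ltr_of_real (s := s)) of_real0 re_ge0K// ltW.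
apply: filterS (ct _ re0) => -[m n] /= tmn.
rewrite -[ltRHS]re_ge0K ?ltW// -nrm_lt; apply: le_lt_trans tmn.
by apply: le_trans (nrm_sum_le _ _) (ler_norm _).
Qed.

Lemma contains_l1_of_lower_bound (c : R) : 0 < c ->
  (forall a n, c * \sum_(0 <= k < n) re `|a k| <=
     nrm (\sum_(0 <= k < n) a k *: x k)) ->
  contains_l1 X.
Proof.
move=> c0 lower; pose T a : X := limn (series (fun n => a n *: x n)).
exists T; split.
  move=> k a b /l1_comb_cvg ca /l1_comb_cvg cb; apply: cvg_lim => //.
  rewrite [X in X @ _ --> _](_ : _ = (k *: series (fun n => a n *: x n)) +
      series (fun n => b n *: x n))%R.
    by apply: cvgD => //; apply: cvgZr.
  apply/funext => n /=; rewrite /series/= !fctE scaler_sumr -big_split/=.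
  by apply: eq_bigr => i _; rewrite scalerDl scalerA.
exists c, 1; split => // a la; rewrite -/(nrm (T a)).
have /cvg_nrmP Ta := l1_comb_cvg la.
have [L -> /(@cvgrPdist_lt _ R^o) tL] := l1_cvg la.
have tail e : 0 < e -> exists n, nrm (T a - \sum_(0 <= k < n) a k *: x k) < e /\
    `|L - \sum_(0 <= k < n) re `|a k| | < e.
  move=> e0; have [N Na] := Ta e e0; have [M _ Ma] := tL e e0.
  exists (maxn N M); split; first by apply: Na; rewrite leq_maxl.
  by apply: Ma => /=; rewrite leq_maxr.
rewrite -!EFinM !lee_fin mul1r; apply/andP; split; apply/ler_addgt0Pr => e e0.
  have [|n [nT nL]] := tail (e / (1 + c)); first by rewrite divr_gt0// addr_gt0.
  have := lower a n; have := nrmD (\sum_(0 <= k < n) a k *: x k - T a) (T a).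
  rewrite subrK nrmB => h1 h2.
  have {}nL : L < \sum_(0 <= k < n) re `|a k| + e / (1 + c).
    by move: nL; rewrite ltr_norml => /andP[]; lra.
  have : c * L <= c * (\sum_(0 <= k < n) re `|a k| + e / (1 + c)).
    by rewrite ler_pM2l// ltW.
  have : e = e / (1 + c) + c * (e / (1 + c)) by field; lra.
  lra.
have [|n [nT nL]] := tail (e / 2); first by rewrite divr_gt0.
have := nrmD (T a - \sum_(0 <= k < n) a k *: x k)
  (\sum_(0 <= k < n) a k *: x k).
have := nrm_sum_le a (index_iota 0 n).
rewrite subrK; move: nL; rewrite ltr_norml => /andP[]; lra.
Qed.

End sequence.

Theorem contains_l1_of_slices :
  slices_reach_sphere (X := X) -> separable X -> contains_l1 X.
Proof.
move=> hX sX; have [G fG cG] := phase_free_uncountable hX.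
have [x [xb xG]] := phase_sequence sX fG cG.
apply: (contains_l1_of_lower_bound xb (c := 8^-1)); first by rewrite invr_gt0.
move=> a n; rewrite ler_pdivrMl//.
have /all_sig[k ak] j : {k | re `|a j| <= 2 * re (phase ^+ k * a j)}.
  exact/cid/rotate.
(* The points are rotated by the inverse [3 * k] of the phase [k] that rotates
   the coefficient. *)
have [v Gv vx] := xG (fun j => 3 * k j)%N n.
have vb := fG.1 v Gv.
apply: (@le_trans _ _ (8 * v (\sum_(0 <= k < n) a k *: x k))); last first.
  by rewrite ler_pM2l//; exact: vb.2.
rewrite (real_linear_sum _ _ _ vb.1) mulr_sumr big_nat [leRHS]big_nat.
apply: ler_sum => j /= jn.
have -> : a j *: x j = (phase ^+ k j * a j) *: (phase ^+ (3 * k j) *: x j).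
  by rewrite scalerA mulrAC -exprD -mulSn exprM phase4 expr1n mul1r.
have e : re `|a j| = re `|phase ^+ k j * a j|.
  by rewrite normrM norm_phase mul1r.
rewrite e; apply: dual_ball_rotated => //; last by rewrite -e.
- by rewrite nrm_phase -unit_ball_nrm.
- exact: vx.
Qed.

End l1_embedding.

(** * Conclusion *)

Theorem theorem6p3 (R : realType) (s : scalar_kind)
    (X : completeNormedModType (scalar_field R s))
    (hX : forall C : set X, is_convex_series_of_slices unit_ball C ->
       C `&` unit_sphere !=set0) :
  SCD (unit_ball : set X) = set0 /\
  (separable X -> ~ SCD_space X /\ contains_l1 X).
Proof.
split; first exact: SCD_unit_ball.
by move=> sX; split; [exact: not_SCD_space|exact: contains_l1_of_slices].
Qed.
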